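(* There exists $n_0$ such that for every $n \ge n_0$ the following holds. Let $t=\frac{1}{4}n^{1/3}$ (rounded to an integer). Let $T_1,T_2,\dots,T_t$ be trees such that for each $i\in\{1,\dots,t\}$ we have $|T_i| = n-i+1$ and at least one of the following holds: (1) $T_i$ has a set of at most $n^{1/3}$ vertices such that the union of their neighborhoods contains at least $n^{2/3}$ leaves of $T_i$; (2) $T_i$ has at least $n^{2/3}$ independent leaves. Then $T_1,T_2,\dots,T_t$ pack into the complete graph $K_n$.
   Context: $|T|$ denotes the number of vertices of $T$. A set of graphs $G_1,\dots,G_m$ packs into a graph $H$ if $G_1,\dots,G_m$ can be found as pairwise edge-disjoint subgraphs of $H$. A leaf is a vertex of degree $1$. A set of leaves is independent if the neighbors of the leaves are pairwise distinct (i.e. the edges incident to these leaves form a matching). The neighborhood of a set $X$ of vertices is the set of vertices not in $X$ having a neighbor in $X$. The paper suppresses integer-part notation, so quantities such as $\frac14 n^{1/3}$ are understood as integers. *)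

(* Defs.v *)
From mathcomp Require Import all_boot all_order.
Set Implicit Arguments. Unset Strict Implicit. Unset Printing Implicit Defensive.

Definition is_tree (m : nat) (e : rel 'I_m) : Prop :=
  [/\ 0 < m,
      (forall x y, e x y = e y x),
      (forall x, ~~ e x x),
      (forall x y, connect e x y) &
      (forall c : seq 'I_m, uniq c -> 2 < size c -> ~~ cycle e c)].

Definition degree (m : nat) (e : rel 'I_m) (v : 'I_m) : nat := #|[set u | e v u]|.

Definition is_leaf (m : nat) (e : rel 'I_m) (v : 'I_m) : bool := degree e v == 1.

Definition cond1 (n m : nat) (e : rel 'I_m) : Prop :=
  exists S : {set 'I_m},
    #|S| ^ 3 <= n /\
    n ^ 2 <= #|[set x | is_leaf e x && (x \notin S) && [exists s in S, e s x]]| ^ 3.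

Definition cond2 (n m : nat) (e : rel 'I_m) : Prop :=
  exists L : {set 'I_m},
    (forall x, x \in L -> is_leaf e x) /\
    (forall x y u, x \in L -> y \in L -> e x u -> e y u -> x = y) /\
    n ^ 2 <= #|L| ^ 3.

(* t = floor(n^{1/3} / 4): largest k with (4k)^3 <= n. *)
Definition tcount (n : nat) : nat := \max_(k < n.+1 | (4 * k) ^ 3 <= n) k.

Definition packs_into_Kn (n : nat) (I : finType) (m : I -> nat)
    (T : forall i, rel 'I_(m i)) : Prop :=
  exists f : forall i, 'I_(m i) -> 'I_n,
    (forall i, injective (f i)) /\
    (forall i j x y u v, i != j -> T i x y -> T j u v ->
       [set f i x; f i y] != [set f j u; f j v]).

(* Main.v *)
(* Fix L of size about n^(2/3) and let A be the set of i for which T_i satisfies (1).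
   A vertex c_i is reserved for every i in A. First embed the trees outside A, in
   any order, keeping every c_i out of the smaller trees T_j (i < j) and making it a leaf
   of the larger ones; then embed the trees in A by increasing order. When T_i is
   embedded, c_i has at most one used edge for each T_j outside A with j < i, so T_i can be put
   on vertices among which c_i is isolated.

   To embed one tree, remove L suitable leaves. Set aside at most L/2 vertices such that in
   the rest every vertex has few used edges; a greedy top-down embedding of the remaining
   tree then succeeds. The parents of the removed leaves must be put at vertices of very
   small degree, so they are embedded first, together with further tree vertices chosen
   so that every other vertex has at most one child embedded in advance. The removed
   leaves are finally placed by a bijection minimising the number of conflicts. In case
   (1) every vertex can receive the leaves at the vertex placed on c_i. In case (2)
   each vertex set aside is assigned in advance to a leaf whose parent is put at a
   non-neighbour of it; this is possible because trees not satisfying (1) have maximum degree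
   about n/2 at most, so that no vertex has much larger degree before A is treated. *)
Require Import Defs.
From mathcomp Require Import all_boot all_order.
From mathcomp Require Import perm zify.
Set Implicit Arguments. Unset Strict Implicit. Unset Printing Implicit Defensive.

(** * Rooted trees *)

Definition rooted (I : finType) (e : rel I) (root : I) (par : I -> I) (d : I -> nat) : Prop :=
  [/\ par root = root,
      forall x, x != root -> e x (par x) /\ d (par x) < d x &
      forall x y, e x y -> par x = y \/ par y = x].

Lemma tree_rooted (m : nat) (e : rel 'I_m) (root : 'I_m) :
  is_tree e -> exists par d, rooted e root par d.
Proof.
case=> _ esym eirr econ eacyc.
pose P (A : {set 'I_m}) := exists par : 'I_m -> 'I_m, exists d : 'I_m -> nat,
  [/\ par root = root,
      forall x, x \in A -> x != root -> [/\ par x \in A, e x (par x) & d (par x) < d x] &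
      forall x y, x \in A -> y \in A -> e x y -> par x = y \/ par y = x].
suff [A [rA PA AT]] : exists A : {set 'I_m}, [/\ root \in A, P A & A = setT].
  case: PA => par [d [h1 h2 h3]]; exists par, d; split=> //.
    by move=> x xr; case: (h2 x _ xr); rewrite ?AT ?inE.
  by move=> x y; apply: h3; rewrite AT inE.
suff H k : 0 < k <= m -> exists A : {set 'I_m}, [/\ root \in A, P A & #|A| = k].
  have m0 : 0 < m := leq_ltn_trans (leq0n _) (ltn_ord root).
  have [|A [rA PA cA]] := H m; first by rewrite m0 leqnn.
  exists A; split=> //; apply/eqP; rewrite eqEcard subsetT /= cardsT card_ord.
  by rewrite cA.
elim: k => // -[_ _|k IH /andP[_ km]].
  exists [set root]; split; rewrite ?inE ?cards1 //.
  exists (fun=> root), (fun=> 0); split=> //.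
    by move=> x; rewrite inE => /eqP->; rewrite eqxx.
  by move=> x y; rewrite !inE => /eqP-> /eqP->; left.
have [|A [rA [par [d [h1 h2 h3]]] cA]] := IH; first by rewrite /= (ltnW km).
have [x [y [xA yA exy]]] : exists x y, [/\ x \in A, y \notin A & e x y].
  have [[x xP]|nx] := altP (@existsP _ (fun x => (x \in A) && [exists y, (y \notin A) && e x y])).
    by case/andP: xP => xA /existsP[y /andP[yA exy]]; exists x, y.
  have cl : closed e (mem A).
    apply: intro_closed.
      by move=> a b; rewrite !econ.
    move=> a b eab aA; apply: contraNT nx => bA.
    by apply/existsP; exists a; rewrite [a \in A]aA; apply/existsP; exists b; rewrite bA.
  have AT : A = setT.
    by apply/setP=> z; rewrite inE -(closed_connect cl (econ root z)).
  by have := km; rewrite -cA AT cardsT card_ord ltnn.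
have conA z : z \in A -> connect [rel a b | [&& e a b, a \in A & b \in A]] z root.
  have [n] := ubnP (d z); elim: n z => // n IHn z dz zA.
  have [->|zr] := eqVneq z root; first exact: connect0.
  have [pA ez dlt] := h2 z zA zr.
  apply: connect_trans (IHn _ _ pA); last by apply: leq_trans dlt _; rewrite -ltnS.
  by apply: connect1; rewrite /= ez zA pA.
have csym : connect_sym [rel a b | [&& e a b, a \in A & b \in A]].
  by apply: sym_connect_sym => a b /=; congr (_ && _); [exact: esym|exact: andbC].
have xuniq x' : x' \in A -> e x' y -> x' = x.
  move=> x'A ex'y; apply/eqP; apply/negPn/negP => neq.
  have: connect [rel a b | [&& e a b, a \in A & b \in A]] x x'.
    by apply: connect_trans (conA _ xA) _; rewrite csym conA.
  case/connectP => p0 p0P x'E; move: neq ex'y; rewrite {}x'E {x'A}; case/shortenP: p0P => p pP up _ neq ex'y.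
  have pA : all (mem A) p.
    elim: p x {xA exy up neq ex'y} pP => //= a p IHp x /andP[/and3P[_ _ ->]] /IHp ->.
    by [].
  have pe : path e x p by apply: sub_path pP => a b /= /and3P[].
  have pn : p != [::] by apply: contra_neq neq => ->.
  have /negP[] : ~~ cycle e (y :: x :: p).
    apply: eacyc; last by case: (p) pn.
    rewrite cons_uniq up andbT inE negb_or (contraNneq _ yA) /=; last by move=> ->.
    by apply: contra yA => /(allP pA).
  by rewrite /= rcons_path pe esym exy ex'y.
exists (y |: A); split; rewrite ?inE ?rA ?orbT ?cardsU1 ?yA ?cA //.
have yr : y != root by apply: contraNneq yA => ->.
exists (fun z => if z == y then x else par z), (fun z => if z == y then (d x).+1 else d z); split.
- by rewrite eq_sym (negPf yr).
- have ny z : z \in A -> (z == y) = false by move=> zA; apply/negbTE; apply: contraNneq yA => <-.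
  move=> z; rewrite !inE; case: eqVneq => [-> _ _|_ /= zA zr].
    by rewrite (ny _ xA) xA orbT esym exy.
  by case: (h2 z zA zr) => pA ez dl; rewrite pA orbT (ny _ pA).
- move=> a b; rewrite !inE; case: (eqVneq a y) => [->|_]; case: (eqVneq b y) => [->|_] //=.
  + by rewrite (negPf (eirr _)).
  + by move=> _ bA eyb; left; rewrite (xuniq b) // esym.
  + by move=> aA _ eay; right; rewrite (xuniq a).
  + exact: h3.
Qed.

Section Rooted.
Variables (I : finType) (e : rel I) (root : I) (par : I -> I) (d : I -> nat).
Hypotheses (esym : symmetric e) (rt : rooted e root par d).

Lemma leaf_nochild x y : #|[set u | e x u]| = 1 -> x != root -> y != root -> par y != x.
Proof.
case: rt => _ h2 _ /eqP/cards1P[u xu] xr yr; apply/eqP => yx.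
have [exp dx] := h2 x xr; have [] := h2 y yr; rewrite yx esym => exy dy.
have pxy : par x = y.
  have : par x \in [set u | e x u] by rewrite inE.
  have : y \in [set u | e x u] by rewrite inE.
  by rewrite xu !inE => /eqP-> /eqP->.
by move: dx; rewrite pxy => dx; have := ltn_trans dx dy; rewrite ltnn.
Qed.
End Rooted.

(* Adding a vertex with two children in X removes at least one vertex whose parent is outside X, so the potential #|X| + #|tops X| never increases. *)
Lemma few_children_closure (I : finType) (par : I -> I) (D S : {set I}) :
  S \subset D -> (forall x, x \in D -> par x \in D) ->
  exists X : {set I}, [/\ S \subset X, X \subset D, #|X| <= 2 * #|S| &
    forall y, y \notin X -> #|[set x in X | par x == y]| <= 1].
Proof.
move=> SD pD; pose tops (X : {set I}) := [set x in X | par x \notin X].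
pose P (X : {set I}) := [&& S \subset X, X \subset D & #|X| + #|tops X| <= 2 * #|S|].
have PS : P S.
  rewrite /P subxx SD mul2n -addnn leq_add2l; apply: subset_leq_card.
  by apply/subsetP => x; rewrite inE => /andP[].
have [X PX Xmax] := @arg_maxnP _ S P (fun X : {set I} => #|X|) PS.
case/and3P: (PX) => SX XD cX; exists X; split=> //; first by apply: leq_trans cX; apply: leq_addr.
move=> y yX; rewrite leqNgt; apply/negP => c2.
set ch := [set x in X | par x == y] in c2.
have: P (y |: X).
  apply/and3P; split.
  - by apply: subset_trans SX (subsetUr _ _).
  - rewrite subUset XD andbT sub1set.
    have /card_gt0P[x] : 0 < #|ch| by apply: ltnW.
    by rewrite inE => /andP[xX /eqP<-]; apply/pD/(subsetP XD).
  - apply: leq_trans cX; rewrite cardsU1 yX.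
    have chs : ch \subset tops X.
      by apply/subsetP => x; rewrite !inE => /andP[-> /eqP->].
    have := cardsID ch (tops X); rewrite (setIidPr chs) => <-.
    have : #|tops (y |: X)| <= #|y |: (tops X :\: ch)|.
      apply: subset_leq_card; apply/subsetP => x; rewrite !inE negb_or.
      case: eqVneq => //= _ /and3P[-> -> ->] //.
    by have := cardsU1 y (tops X :\: ch); lia.
by move=> /Xmax /=; rewrite cardsU1 yX; lia.
Qed.

(* A bijection with the fewest conflicts has none: a conflicting pair could be swapped with another pair without creating conflicts. *)
Lemma conflict_free_bijection (I U : finType) (u0 : U) (A : {set I}) (R : {set U}) (c : I -> U -> bool) :
  #|A| = #|R| ->
  (forall a r, a \in A -> r \in R -> c a r ->
    #|[set r' in R | c a r']| + #|[set a' in A | c a' r]| <= #|A|) ->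
  exists f : I -> U, [/\ {in A &, injective f}, forall a, a \in A -> f a \in R &
    forall a, a \in A -> ~~ c a (f a)].
Proof.
move=> AR cdeg.
pose P (f : {ffun I -> U}) := [forall a in A, f a \in R] && dinjectiveb f (mem A).
pose f0 : {ffun I -> U} := [ffun a => nth u0 (enum R) (index a (enum A))].
have szAR : size (enum A) = size (enum R) by rewrite -!cardE.
have Pf0 : P f0.
  apply/andP; split.
    apply/'forall_implyP => a aA; rewrite ffunE -mem_enum mem_nth //.
    by rewrite -szAR index_mem mem_enum.
  apply/dinjectiveP => a b aA bA; rewrite !ffunE => /eqP.
  rewrite nth_uniq ?enum_uniq -?szAR ?index_mem ?mem_enum // => /eqP ab.
  by have := congr1 (nth a (enum A)) ab; rewrite !nth_index ?mem_enum.
have [f Pf fmin] := @arg_minnP _ f0 P (fun f : {ffun I -> U} => #|[set a in A | c a (f a)]|) Pf0.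
case/andP: (Pf) => /'forall_implyP fR /dinjectiveP finj.
exists f; split=> // a aA; apply/negP => caf.
have [b [bA cab cba]] : exists b, [/\ b \in A, ~~ c a (f b) & ~~ c b (f a)].
  pose B1 := [set b in A | c a (f b)]; pose B2 := [set b in A | c b (f a)].
  have cB1 : #|B1| <= #|[set r' in R | c a r']|.
    have fB : {in B1 &, injective f}.
      by move=> x y /setIdP[xA _] /setIdP[yA _]; apply: finj.
    rewrite -(card_in_imset fB).
    apply/subset_leq_card/subsetP => r /imsetP[x /setIdP[xA cx] ->].
    by rewrite inE fR.
  have := cdeg a (f a) aA (fR _ aA) caf; rewrite -/B2 => cd.
  have := cardsU B1 B2.
  have : 0 < #|B1 :&: B2| by apply/card_gt0P; exists a; rewrite !inE aA caf.
  move=> cI cU; have : B1 :|: B2 \proper A.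
    rewrite properEcard; apply/andP; split; last first.
      by have : 0 < #|A| by [apply/card_gt0P; exists a]; lia.
    by apply/subsetP => x; rewrite !inE => /orP[] /andP[].
  by case/properP => _ [b bA]; rewrite !inE bA negb_or => /andP[? ?]; exists b.
pose f' : {ffun I -> U} := [ffun x => f (tperm a b x)].
have swA x : x \in A -> tperm a b x \in A by case: tpermP => // ->.
have /fmin : P f'.
  apply/andP; split; first by apply/'forall_implyP => x xA; rewrite ffunE fR ?swA.
  apply/dinjectiveP => x y xA yA; rewrite !ffunE => /finj H.
  by apply: (@perm_inj _ (tperm a b)); apply: H; apply: swA.
apply/negP; rewrite -ltnNge; apply: proper_card; apply/properP; split.
  apply/subsetP => x; rewrite !inE ffunE => /andP[->] /=.
  by case: tpermP => [->|->|//]; rewrite ?(negPf cab) ?(negPf cba).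
by exists a; rewrite !inE aA ?caf // ffunE tpermL cab.
Qed.

(** * Greedy embedding *)

Definition nbr (U : finType) (g : rel U) (v : U) : {set U} := [set u | g v u].

Lemma small_degree_core (U : finType) (g : rel U) (V : {set U}) (h D : nat) :
  symmetric g -> irreflexive g ->
  \sum_(v in V) #|V :&: nbr g v| < 2 * h * D.+1 ->
  exists H : {set U}, [/\ H \subset V, #|H| <= h,
    forall v, v \in H -> D < #|V :&: nbr g v| &
    forall v, v \in V :\: H -> #|(V :\: H) :&: nbr g v| <= D].
Proof.
move=> gs gi; elim: h V => [|h IH] V lt; first by move: lt; rewrite muln0 mul0n ltn0.
have [/existsP[v /andP[vV dv]]|no] := boolP [exists v in V, D < #|V :&: nbr g v|]; last first.
  exists set0; rewrite sub0set cards0 setD0; split=> // v; rewrite ?inE // => vV.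
  by rewrite leqNgt; apply: contra no => ?; apply/existsP; exists v; rewrite vV.
have vv : V :&: nbr g v = (V :\ v) :&: nbr g v.
  by apply/setP => u; rewrite !inE; case: eqVneq => // ->; rewrite gi andbF.
have [|H [HV cH Hb Hd]] := IH (V :\ v).
  move: lt; rewrite (big_setD1 v vV) /= (eq_bigr (fun u => g u v + #|(V :\ v) :&: nbr g u|)); last first.
    move=> u _; rewrite (cardsD1 v) !inE vV /=; congr (_ + #|pred_of_set _|).
    by apply/setP => w; rewrite !inE andbA.
  rewrite big_split /= (_ : \sum_(i in V :\ v) g i v = #|V :&: nbr g v|); last first.
    rewrite vv -sum1_card big_mkcond [RHS]big_mkcond /=; apply: eq_bigr => u _.
    by rewrite !inE gs; do 3!case: ifP => //=; case: (g v u); rewrite ?andbF // andbT => ->.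
  by nia.
exists (v |: H); split.
- by rewrite subUset sub1set vV (subset_trans HV) // subD1set.
- by rewrite cardsU1; case: (v \notin H) => /=; lia.
- move=> u; rewrite !inE => /orP[/eqP->//|/Hb lt']; apply: leq_trans lt' _.
  by apply/subset_leq_card/setSI/subD1set.
- by rewrite -setDDl.
Qed.

Lemma few_large_degrees (U : finType) (g : rel U) (V : {set U}) (D : nat) :
  D.+1 * #|[set v in V | D < #|V :&: nbr g v|]| <= \sum_(v in V) #|V :&: nbr g v|.
Proof.
rewrite mulnC -sum_nat_const big_mkcond [leqRHS]big_mkcond /=.
by apply: leq_sum => v _; rewrite !inE; case: (v \in V) => //=; case: ltnP.
Qed.

Section Greedy.
Variables (I U : finType) (g : rel U) (par : I -> I).
Hypotheses (gs : symmetric g) (gi : irreflexive g).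

Definition good_on (A : {set I}) (phi : I -> U) :=
  {in A &, injective phi} /\
  forall x, x \in A -> par x \in A -> ~~ g (phi x) (phi (par x)).

Variable d : I -> nat.
Hypothesis dpar : forall x, par x = x \/ d (par x) < d x.

Lemma greedy_extension (A0 D : {set I}) (phi0 : I -> U) (Cand : I -> {set U}) (a b : nat) :
  A0 \subset D -> good_on A0 phi0 -> (forall x, x \in A0 -> phi0 x \in Cand x) ->
  (forall y q, y \in D :\: A0 -> par y \in D -> q \in Cand (par y) ->
    #|Cand y :&: nbr g q| <= a) ->
  (forall y, y \in D :\: A0 ->
    #|[set p in Cand y | [exists x in A0, (par x == y) && g (phi0 x) p]]| <= b) ->
  (forall y, y \in D :\: A0 -> #|D| + a + b <= #|Cand y|) ->
  exists phi, [/\ {in A0, phi =1 phi0}, good_on D phi & forall x, x \in D -> phi x \in Cand x].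
Proof.
move=> AD good0 Cand0 Ha Hb Hc.
suff H (A : {set I}) phi : A0 \subset A -> A \subset D -> {in A0, phi =1 phi0} ->
    good_on A phi -> (forall x, x \in A -> phi x \in Cand x) ->
    (forall x z, x \in A :\: A0 -> z \in D :\: A -> d x <= d z) ->
    exists phi, [/\ {in A0, phi =1 phi0}, good_on D phi & forall x, x \in D -> phi x \in Cand x].
  by apply: (H A0 phi0) => // x z; rewrite setDv inE.
have [n] := ubnP #|D :\: A|; elim: n A phi => // n IH A phi cDA A0A AD' agr [inj gd] cd ord.
have [DA0|[y0 y0D]] := set_0Vmem (D :\: A).
  have -> : D = A by apply/eqP; rewrite eqEsubset AD' andbT -setD_eq0 DA0.
  by exists phi.
have [y yDA ymin] := @arg_minnP _ y0 (mem (D :\: A)) d y0D.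
have {}yDA : y \in D :\: A by [].
have /setDP[yD yA] := yDA.
have yDA0 : y \in D :\: A0 by rewrite inE yD andbT; apply: contra yA; apply: (subsetP A0A).
pose F1 := if par y \in A then Cand y :&: nbr g (phi (par y)) else set0.
pose F2 := [set p in Cand y | [exists x in A0, (par x == y) && g (phi0 x) p]].
have cF1 : #|F1| <= a.
  rewrite /F1; case: ifP => pA; last by rewrite cards0.
  by apply: Ha => //; [apply: (subsetP AD')|apply: cd].
have cA : #|A| < #|D| by apply: proper_card; apply/properP; split=> //; exists y.
have [p pC] : exists p, p \in Cand y :\: ((phi @: A) :|: F1 :|: F2).
  apply/set0Pn; rewrite -card_gt0.
  have := cardsID ((phi @: A) :|: F1 :|: F2) (Cand y).
  have := leq_imset_card phi A.
  have := subset_leq_card (subsetIr (Cand y) (phi @: A :|: F1 :|: F2)).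
  have := (leq_card_setU (phi @: A :|: F1) F2).1.
  have := (leq_card_setU (phi @: A) F1).1.
  have := Hb y yDA0; have := Hc y yDA0; rewrite -/F2; lia.
move: pC; rewrite inE !in_setU !negb_or => /andP[/andP[/andP[pA pF1] pF2] pC].
pose phi' x := if x == y then p else phi x.
have phiA x : x \in A -> phi' x = phi x.
  by move=> xA; rewrite /phi'; case: eqP => // xy; move: yA; rewrite -xy xA.
have phiy : phi' y = p by rewrite /phi' eqxx.
have npA x : x \in A -> p != phi x by move=> xA; apply: contra pA => /eqP->; apply: imset_f.
apply: (IH (y |: A) phi').
- have -> : D :\: (y |: A) = (D :\: A) :\ y.
    by apply/setP => z; rewrite !inE negb_or andbA.
  by move: cDA; rewrite (cardsD1 y) yDA add1n ltnS.
- by apply: subset_trans A0A (subsetUr _ _).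
- by rewrite subUset sub1set yD.
- by move=> x xA0; rewrite phiA ?agr // (subsetP A0A).
- split=> [x z|x].
    rewrite !in_setU1 => /orP[/eqP->|xA] /orP[/eqP->|zA] //; rewrite ?phiy ?phiA //.
    + by move/eqP; rewrite (negPf (npA _ zA)).
    + by move/eqP; rewrite eq_sym (negPf (npA _ xA)).
    + exact: inj.
  rewrite !in_setU1 => /orP[/eqP->|xA] /orP[/eqP pE|pxA].
  + by rewrite pE gi.
  + rewrite phiy phiA // gs; apply: contra pF1 => gp.
    by rewrite /F1 pxA !inE pC gp.
  + rewrite pE phiy phiA //; apply/negP => gp.
    have [xA0|xA0] := boolP (x \in A0).
      case/negP: pF2; rewrite !inE pC /=; apply/existsP; exists x.
      by rewrite xA0 pE eqxx -agr.
    have := ord x y; rewrite yDA !inE xA xA0 => /(_ isT isT).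
    case: (dpar x) => [px|]; last by rewrite pE ltnNge => /negPf->.
    by move: yA; rewrite -pE px xA.
  + by rewrite !phiA //; apply: gd.
- by move=> x; rewrite in_setU1 => /orP[/eqP->|xA]; rewrite ?phiy // phiA // cd.
- move=> x z; rewrite !inE negb_or => /andP[xA0 /orP[/eqP->|xA]] /andP[/andP[_ zA] zD].
    by apply: ymin; rewrite /= inE zA.
  by apply: ord; rewrite !inE ?xA0 ?zA.
Qed.

End Greedy.

Lemma exists_between_card (T : finType) (A B : {set T}) (s : nat) :
  A \subset B -> #|A| <= s <= #|B| -> exists C : {set T}, [/\ A \subset C, C \subset B & #|C| = s].
Proof.
move=> AB /andP[As sB]; elim: s As sB => [|s IH] As sB.
  by exists A; split=> //; apply/eqP; rewrite -leqn0.
have [As'|As'] := eqVneq #|A| s.+1; first by exists A.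
have [||C [AC CB cC]] := IH; [by rewrite -ltnS ltn_neqAle As'|exact: ltnW|].
have : C \proper B by rewrite properEcard CB cC.
case/properP => _ [x xB xC]; exists (x |: C); split.
- by apply: subset_trans AC (subsetUr _ _).
- by rewrite subUset sub1set xB.
- by rewrite cardsU1 xC cC.
Qed.

Lemma skeleton_embedding (I U : finType) (g : rel U) (par : I -> I) (d : I -> nat)
    (A0 S D : {set I}) (W : {set U}) (Cand : I -> {set U}) (phi0 : I -> U) (a b : nat) :
  symmetric g -> irreflexive g ->
  (forall x, par x = x \/ d (par x) < d x) ->
  A0 \subset S -> S \subset D -> (forall x, x \in D -> par x \in D) ->
  good_on g par A0 phi0 -> (forall x, x \in A0 -> par x \in A0 /\ phi0 x \in Cand x) ->
  (forall x, Cand x \subset W) ->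
  (forall x q, q \in Cand x -> #|W :&: nbr g q| <= b) ->
  (forall x, x \notin A0 -> 2 * #|S| + b <= #|Cand x|) ->
  (forall v, v \in W -> #|W :&: nbr g v| <= a) ->
  #|D| + a + b <= #|W| ->
  exists phi, [/\ {in A0, phi =1 phi0}, good_on g par D phi,
    forall x, x \in D -> phi x \in W & forall x, x \in S -> phi x \in Cand x].
Proof.
move=> gs gi dpar AS SD pD good0 A0P CW Cb Cc Wa Wc.
have [X [SX XD cX Xch]] := few_children_closure SD pD.
have [||||||phi1 [agr1 good1 cand1]] :=
    @greedy_extension I U g par gs gi d dpar A0 X phi0 Cand b 0.
- exact: subset_trans SX.
- by [].
- by move=> x /A0P[].
- by move=> y q _ _ qC; apply: leq_trans (Cb _ _ qC); apply/subset_leq_card/setSI.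
- move=> y /setDP[_ yA0]; rewrite leqn0 cards_eq0; apply/eqP/setP => p; rewrite !inE.
  apply/negbTE/negP => /andP[_ /existsP[x /and3P[xA0 /eqP pxy _]]].
  by case/negP: yA0; rewrite -pxy; case: (A0P x xA0).
- by move=> y /setDP[_ yA0]; apply: leq_trans (Cc y yA0); rewrite addn0 leq_add2r.
have [||||||phi [agr good cand]] :=
    @greedy_extension I U g par gs gi d dpar X D phi1 (fun=> W) a b.
- exact: XD.
- by [].
- by move=> x /cand1; apply/subsetP.
- by move=> y q _ _ /Wa.
- move=> y /setDP[_ yX].
  have [->|[p0]] := set_0Vmem [set p in W | [exists x in X, (par x == y) && g (phi1 x) p]].
    by rewrite cards0.
  rewrite inE => /andP[_ /existsP[x0 /and3P[x0X px0 _]]].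
  apply: leq_trans (Cb x0 (phi1 x0) (cand1 _ x0X)); apply/subset_leq_card/subsetP => p.
  rewrite !inE => /andP[-> /existsP[x /and3P[xX px gp]]] /=.
  suff -> : x0 = x by [].
  apply/eqP; have := Xch y yX; apply: contraTT => nx; rewrite -ltnNge.
  have <- : #|[set x0; x]| = 2 by rewrite cards2 nx.
  by apply/subset_leq_card/subsetP => z; rewrite !inE => /orP[] /eqP->; rewrite ?x0X ?xX.
- by [].
exists phi; split=> //.
- by move=> x xA; rewrite agr ?agr1 //; apply: (subsetP SX); apply: (subsetP AS).
- by move=> x xS; rewrite agr ?(subsetP SX) //; apply/cand1/(subsetP SX).
Qed.

Lemma attach_leaves (I U : finType) (e : rel I) (g : rel U) (root : I) (par : I -> I) (d : I -> nat)
    (B : {set I}) (V : {set U}) (phi psi : I -> U) :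
  symmetric g -> rooted e root par d ->
  (forall x, par x \notin B) ->
  good_on g par (~: B) phi -> (forall x, x \notin B -> phi x \in V) ->
  {in B &, injective psi} -> (forall x, x \in B -> psi x \in V :\: phi @: (~: B)) ->
  (forall x, x \in B -> ~~ g (phi (par x)) (psi x)) ->
  exists f : I -> U, [/\ injective f, forall x, f x \in V,
    forall x y, e x y -> ~~ g (f x) (f y),
    {in ~: B, f =1 phi} & {in B, f =1 psi}].
Proof.
move=> gs [_ _ er] pB [inj gd] phiV pinj psiV conf.
exists (fun x => if x \in B then psi x else phi x); split.
- move=> x y; have [xB|xB] := boolP (x \in B); have [yB|yB] := boolP (y \in B).
  + exact: pinj.
  + move=> E; have := psiV x xB; rewrite inE E => /andP[/negP[]].
    by rewrite imset_f // inE.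
  + move=> E; have := psiV y yB; rewrite inE -E => /andP[/negP[]].
    by rewrite imset_f // inE.
  + by apply: inj; rewrite inE.
- by move=> x; case: ifPn => [/psiV/setDP[]|/phiV].
- have H x : ~~ g (if x \in B then psi x else phi x) (phi (par x)).
    case: ifPn => [xB|xB]; first by rewrite gs conf.
    by apply: gd; rewrite inE.
  move=> x y exy; case: (er x y exy) => <-.
    by rewrite (negPf (pB x)).
  by rewrite gs (negPf (pB y)).
- by move=> x; rewrite inE => /negPf->.
- by move=> x ->.
Qed.

(** * Embedding a single tree *)

(* k is n^(1/3) / 4 and L is n^(2/3), both up to rounding. *)
Definition scale (n k L : nat) : Prop :=
  [/\ 100 <= k, (4 * k) ^ 3 <= n, n ^ 2 <= L ^ 3 & (L - 1) ^ 3 < n ^ 2].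

(* The second inequality is where t = n^(1/3) / 4 is needed: (k - 1) * n bounds the number of used edges, h = L / 2 vertices of large degree are set aside, and each tree vertex must avoid at most L - h - 7k positions because of its parent. *)
Lemma scale_arith n k L : 100 <= k -> (4 * k) ^ 3 <= n -> n ^ 2 <= L ^ 3 -> (L - 1) ^ 3 < n ^ 2 ->
  let h := L./2 in
  [/\ 4 * k * (L - 1) < n, (k - 1) * n < h * (L - h - 7 * k).+1, h + 7 * k <= L & 1000 * k <= n].
Proof.
move=> k100 kn nL Ln h.
have f1 : 4 * k * (L - 1) < n.
  rewrite -(ltn_exp2r _ _ (isT : 0 < 3)) expnMn [n ^ 3]expnS.
  apply: leq_ltn_trans (leq_mul kn (leqnn _)) _; rewrite ltn_pmul2l //.
  by apply: leq_trans kn; rewrite expn_gt0; lia.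
have f2 : 4 * k * n <= L ^ 2.
  rewrite -(leq_exp2r _ _ (isT : 0 < 3)) expnMn -expnM [2 * 3]mulnC expnM.
  apply: leq_trans (leq_mul kn (leqnn _)) _; rewrite -expnS -[4]/(2 * 2) expnM.
  by rewrite leq_exp2r.
have f4 : 1000 * k <= n.
  apply: leq_trans kn; rewrite !expnS expn0 muln1 mulnA leq_mul //; first by nia.
  by lia.
have f5 : 16 * k * k <= L.
  have : (16 * k * k) ^ 2 <= L ^ 2.
    apply: leq_trans f2; rewrite (_ : (16 * k * k) ^ 2 = 4 * k * (4 * k) ^ 3).
      by rewrite leq_mul2l kn orbT.
    by rewrite !expnS !expn0; nia.
  by rewrite leq_exp2r.
have f5' : 100 * (16 * k) <= L.
  by apply: leq_trans f5; rewrite mulnC leq_mul.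
have Lh : L = h + h \/ L = (h + h).+1.
  by have := odd_double_half L; rewrite -/h -addnn; case: (odd L) => /= <-; [right|left].
have f6 : h + 7 * k <= L by lia.
split=> //.
rewrite expnS expn1 in f2.
clear kn nL Ln f5.
have hk : k * n <= h * (L - h).
  case: Lh => E; rewrite E in f2 *.
    by rewrite addnK; lia.
  by rewrite -addnS addKn; lia.
have e2 : 8 * (k * h) <= n + 4 * k.
  have : 4 * k * (h + h - 1) < n.
    by apply: leq_ltn_trans f1; rewrite leq_mul2l; apply/orP; right; lia.
  by rewrite mulnBr; lia.
have [r rE] : exists r, L - h = r + 7 * k by exists (L - h - 7 * k); lia.
rewrite rE addnK; rewrite rE in hk.
have e3 : (k - 1) * n + n = k * n by rewrite -mulSnr subn1 prednK //; lia.
by lia.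
Qed.

Lemma scale_linear n k L : scale n k L -> 400 * (L - 1) < n.
Proof.
move=> [k100 kn nL Ln]; have [f1 _ _ _] := scale_arith k100 kn nL Ln.
by apply: leq_ltn_trans f1; rewrite leq_mul2r; apply/orP; right; lia.
Qed.

Lemma large_cube n k L x : scale n k L -> n ^ 2 <= x ^ 3 -> L <= x.
Proof.
move=> [_ _ _ Ln] nx; have := leq_trans Ln nx; rewrite ltn_exp2r //; lia.
Qed.

Section LeafFacts.
Variables (I : finType) (e : rel I) (root : I) (par : I -> I) (d : I -> nat).
Hypotheses (e_sym : symmetric e) (rt : rooted e root par d).

Lemma leaf_parent x y : #|nbr e x| = 1 -> x != root -> e x y -> par x = y.
Proof.
case: rt => _ h2 _ /eqP/cards1P[u xu] xr exy.
have /eqP-> : par x == u by rewrite -in_set1 -xu inE; case: (h2 x xr).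
by apply/esym/eqP; rewrite -in_set1 -xu inE.
Qed.

Lemma parent_notin_leaves (B : {set I}) : root \notin B ->
  (forall x, x \in B -> #|nbr e x| = 1) -> forall x, par x \notin B.
Proof.
move=> rB lB x; have [->|xr] := eqVneq x root; first by case: rt => ->.
apply/negP => pB; have pr : par x != root by apply: contraNneq rB => <-.
by have := leaf_nochild e_sym rt (lB _ pB) pr xr; rewrite eqxx.
Qed.

Lemma rooted_decreasing x : par x = x \/ d (par x) < d x.
Proof.
case: rt => pr h2 _; have [->|/h2[]] := eqVneq x root; first by left.
by right.
Qed.
End LeafFacts.

Lemma card_setD_imset (I U : finType) (D : {set I}) (V : {set U}) (phi : I -> U) :
  {in D &, injective phi} -> (forall x, x \in D -> phi x \in V) ->
  #|V :\: phi @: D| = #|V| - #|D|.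
Proof.
move=> inj phiV; rewrite cardsD (setIidPr _) ?card_in_imset //.
by apply/subsetP => _ /imsetP[x xD ->]; apply: phiV.
Qed.

Lemma card_low (U : finType) (g : rel U) (V W : {set U}) (b c s n : nat) :
  W \subset V -> \sum_(v in V) #|V :&: nbr g v| <= s -> c * s <= n * b.+1 -> 
  c * (#|W| - #|[set v in W | #|V :&: nbr g v| <= b]|) <= n.
Proof.
move=> WV ss csn; rewrite -(leq_pmul2r (ltn0Sn b)); apply: leq_trans csn.
rewrite -mulnA leq_mul2l; apply/orP; right; apply: leq_trans ss.
apply: leq_trans (few_large_degrees g V b); rewrite mulnC leq_mul2l; apply/orP; right.
rewrite leq_subLR -cardsUI; apply: leq_trans (leq_addr _ _).
apply/subset_leq_card/subsetP => v vW; rewrite !inE vW (subsetP WV) //=.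
by case: leqP.
Qed.

Lemma embed_cond1 (U : finType) (g : rel U) (V : {set U}) (c : U) (n k L m : nat) (e : rel 'I_m) :
  scale n k L -> n - k <= m -> is_tree e -> cond1 n e ->
  symmetric g -> irreflexive g -> #|V| = m -> c \in V -> (forall u, u \in V -> ~~ g c u) ->
  \sum_(v in V) #|V :&: nbr g v| <= 2 * (k - 1) * n ->
  exists f : 'I_m -> U, [/\ injective f, forall x, f x \in V &
    forall x y, e x y -> ~~ g (f x) (f y)].
Proof.
move=> sc nm tr [S [cS cLf]] gs gi cV cinV ciso sumV.
have lin := scale_linear sc; have Lf_large := large_cube sc cLf.
case: (sc) => k100 kn nL Ln; have [_ f3 f4 f5] := scale_arith k100 kn nL Ln.
have [B [_ BL cB]] := @exists_between_card _ set0 _ L (sub0set _) (introT andP (conj (leq_trans (eq_leq (cards0 _)) (leq0n _)) Lf_large)).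
have BP x : x \in B -> [/\ #|nbr e x| = 1, x \notin S & exists2 s, s \in S & e s x].
  move=> /(subsetP BL); rewrite inE => /andP[/andP[/eqP lx xS] /existsP[s /andP[sS esx]]].
  by split=> //; exists s.
have [_ esym eirr _ _] := tr.
pose l s := #|[set x in B | e s x]|.
have [s1 s1S] : exists s, s \in S.
  have /card_gt0P[x /BP[_ _ [s sS _]]] : 0 < #|B| by rewrite cB; clear -f4 k100; lia.
  by exists s.
have [s0 s0S smax] := @arg_maxnP _ s1 (mem S) l s1S.
have {}s0S : s0 \in S by [].
have lS : L <= #|S| * l s0.
  rewrite -cB -sum_nat_const -sum1_card.
  apply: (@leq_trans (\sum_(x in B) \sum_(s in S) e s x)).
    apply: leq_sum => x /BP[_ _ [s sS esx]].
    by rewrite (bigD1 s) //= esx.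
  rewrite exchange_big /=; apply: leq_sum => s sS; apply: leq_trans (smax s sS).
  by rewrite /l -sum1_card big_mkcond [leqRHS]big_mkcond; apply: leq_sum => x _; rewrite inE; case: (x \in B) => //=; case: (e s x).
have l0 : 4 * k <= l s0.
  rewrite leqNgt; apply/negP => l0.
  have : L ^ 3 < n ^ 2.
    apply: (@leq_ltn_trans (n * (l s0) ^ 3)).
      by apply: leq_trans (leq_mul cS (leqnn _)); rewrite -expnMn leq_exp2r.
    apply: (@leq_trans (n * (4 * k) ^ 3)); last by rewrite [n ^ 2]expnS expn1 leq_mul.
    by rewrite ltn_pmul2l ?ltn_exp2r //; clear -f5 k100; lia.
  by rewrite ltnNge nL.
have [par [d rt]] := tree_rooted s0 tr.
have s0B : s0 \notin B by apply/negP => /BP[_]; rewrite s0S.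
have pB := parent_notin_leaves esym rt s0B (fun x xB => let: And3 h _ _ := BP x xB in h).
have leafp x s : x \in B -> e s x -> par x = s.
  move=> xB esx; apply: (leaf_parent rt); [by case: (BP x xB)|by apply: contraNneq s0B => <-|by rewrite esym].
have pS x : x \in B -> par x \in S.
  by move=> xB; case: (BP x xB) => _ _ [s sS /(leafp _ _ xB) ->].
set h := L./2 in f3 f4; set D := L - h - 7 * k.
have [|H [HV cH Hbig Hd]] := @small_degree_core _ g V h D gs gi.
  by apply: leq_ltn_trans sumV _; rewrite -!mulnA ltn_mul2l.
set W := V :\: H in Hd; have WV : W \subset V by apply: subsetDl.
have nc : V :&: nbr g c = set0.
  by apply/setP => u; rewrite !inE; apply/negbTE/negP => /andP[/ciso/negPf->].
have cW : c \in W.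
  by rewrite inE cinV andbT; apply/negP => /Hbig; rewrite nc cards0.
have hW : m - h <= #|W|.
  by rewrite cardsD (setIidPr HV) cV; apply: leq_sub2l.
pose Low := [set v in W | #|V :&: nbr g v| <= 4 * k].
have cLow : 2 * (#|W| - #|Low|) <= n.
  apply: card_low WV sumV _; rewrite mulnA [leqRHS]mulnC leq_mul2r; apply/orP; right.
  by clear -k100; lia.
have cS' : #|S| <= L.
  rewrite -(leq_exp2r _ _ (isT : 0 < 3)); apply: leq_trans cS (leq_trans _ nL).
  by rewrite expnS expn1 leq_pmulr //; clear -f5 k100; lia.
have hL : h <= L by apply: leq_trans f4; apply: leq_addr.
have [|||||||||||phi [agr gphi phiW phiS]] :=
    @skeleton_embedding _ _ g par d [set s0] S (~: B) W (fun=> Low) (fun=> c) D (4 * k) gs gi.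
- exact: rooted_decreasing rt.
- by rewrite sub1set.
- by apply/subsetP => x xS; rewrite inE; apply/negP => /BP[_]; rewrite xS.
- by move=> x _; rewrite inE.
- split; first by move=> x y; rewrite !inE => /eqP-> /eqP->.
  by move=> x _ _; rewrite gi.
- move=> x /set1P->; case: rt => -> _ _; split; first exact: set11.
  by rewrite inE cW nc cards0.
- by move=> x; apply/subsetP => v; rewrite inE => /andP[].
- move=> x q; rewrite inE => /andP[_]; apply: leq_trans.
  by apply/subset_leq_card/setSI.
- by move=> x _ /=; move: cS' cLow hW hL; clearbody h Low; move: #|S| #|Low| #|W| => s l' w; clear -nm lin f5 k100; lia.
- exact: Hd.
- have := cardsC B; rewrite cB card_ord; clear -cLow hW f4 hL lin f5 nm k100; rewrite /D; lia.
have phiV x : x \in ~: B -> phi x \in V by move=> /phiW; apply: (subsetP WV).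
have cR : #|B| = #|V :\: phi @: (~: B)|.
  by rewrite (card_setD_imset gphi.1 phiV) cV; have := cardsC B; rewrite card_ord; clear; lia.
have [|psi [pinj pR pc]] := @conflict_free_bijection _ _ c B _ (fun x r => g (phi (par x)) r) cR.
  move=> a r aB rR _; rewrite cB.
  have r1 : #|[set r' in V :\: phi @: (~: B) | g (phi (par a)) r']| <= 4 * k.
    have := phiS _ (pS a aB); rewrite inE => /andP[_]; apply: leq_trans.
    apply/subset_leq_card/subsetP => v; rewrite !inE => /andP[/andP[_ ->] ->] //.
  have r2 : #|[set a' in B | g (phi (par a')) r]| <= L - l s0.
    have lB : [set x in B | e s0 x] \subset B by apply/subsetP => x /setIdP[].
    have := cardsD B [set x in B | e s0 x]; rewrite (setIidPr lB) cB -/(l s0) => <-.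
    apply/subset_leq_card/subsetP => x; rewrite !inE => /andP[xB gx]; rewrite xB /= andbT.
    apply/negP => es; move: gx; rewrite (leafp _ _ xB es) agr ?inE //.
    by apply/negP/ciso; case/setDP: rR.
  have r3 : l s0 <= L by rewrite -cB; apply/subset_leq_card/subsetP => x /setIdP[].
  by clear -r1 r2 r3 l0; lia.
have [|f [finj fV fg _ _]] := @attach_leaves _ _ e g s0 par d B V phi psi gs rt pB gphi _ pinj pR pc.
  by move=> x xB; apply: phiV; rewrite inE.
by exists f.
Qed.

(* A neighbour of v that is not a leaf has a further neighbour, and these are distinct and not adjacent to v. *)
Lemma degree_not_cond1 (n k L m : nat) (e : rel 'I_m) (v : 'I_m) :
  scale n k L -> m <= n -> is_tree e -> ~ cond1 n e -> 2 * #|nbr e v| <= n + L.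
Proof.
move=> [k100 kn nL _] mn tr nc.
have [par [d rt]] := tree_rooted v tr; have [_ esym eirr _ _] := tr.
case: (rt) => pv _ er.
pose A := [set x | is_leaf e x && (x \notin [set v]) && [exists s in [set v], e s x]].
have cA : #|A| < L.
  rewrite ltnNge; apply/negP => LA; apply: nc; exists [set v]; split.
    by rewrite cards1 exp1n; apply: leq_trans kn; rewrite expn_gt0; clear -k100; lia.
  by apply: leq_trans nL _; rewrite leq_exp2r.
have parN x : e v x -> par x = v.
  by move=> evx; case: (er _ _ evx) => // E; move: evx; rewrite -E pv (negPf (eirr _)).
pose psi x := odflt x [pick y | e x y && (y != v)].
have psiP x : x \in nbr e v :\: A -> par (psi x) = x /\ psi x \notin nbr e v.
  rewrite !inE => /andP[xA evx]; rewrite /psi; case: pickP => [y /andP[exy yv]|no] /=.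
    have pyx : par y = x by case: (er _ _ exy) => // E; move: yv; rewrite -E parN ?eqxx.
    split=> //; apply/negP => /parN; rewrite pyx => xv.
    by move: evx; rewrite xv (negPf (eirr _)).
  case/negP: xA; apply/andP; split; last by apply/existsP; exists v; rewrite inE eqxx evx.
  apply/andP; split; last by apply: contraTneq evx => ->; rewrite (negPf (eirr _)).
  apply/cards1P; exists v; apply/setP => y; rewrite !inE.
  have [->|yv] := eqVneq y v; first by rewrite esym.
  by have := no y; rewrite yv andbT.
have injpsi : {in nbr e v :\: A &, injective psi}.
  by move=> x y /psiP[px _] /psiP[py _] E; rewrite -px E py.
have c1 : #|nbr e v :|: psi @: (nbr e v :\: A)| <= m.
  by have := subset_leq_card (subsetT (nbr e v :|: psi @: (nbr e v :\: A))); rewrite cardsT card_ord.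
have I0 : nbr e v :&: psi @: (nbr e v :\: A) = set0.
  apply/setP => y; rewrite [RHS]inE; apply/negbTE/negP => /setIP[yN /imsetP[x /psiP[_ /negP]]].
  by move=> H E; apply: H; rewrite -E.
move: c1; rewrite cardsU I0 cards0 subn0 (card_in_imset injpsi).
have := leq_trans (eq_leq (cardsD (nbr e v) A)) (leqnn _).
have := subset_leq_card (subsetIr (nbr e v) A).
rewrite cardsD; move: #|nbr e v :&: A| #|A| cA #|nbr e v| => p a cA q.
by clear -cA mn; lia.
Qed.

Lemma embed_cond2 (U : finType) (g : rel U) (V C : {set U}) (n k L m : nat) (e : rel 'I_m) :
  scale n k L -> n - k <= m -> is_tree e -> cond2 n e ->
  symmetric g -> irreflexive g -> #|V| = m -> C \subset V -> #|C| <= k ->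
  (forall v, v \in V -> 2 * #|V :&: nbr g v| <= n + 3 * L + 4 * k) ->
  \sum_(v in V) #|V :&: nbr g v| <= 2 * (k - 1) * n ->
  exists f : 'I_m -> U, [/\ injective f, forall x, f x \in V,
    forall x y, e x y -> ~~ g (f x) (f y) &
    forall x, #|nbr e x| = 1 \/ f x \notin C /\ #|V :&: nbr g (f x)| <= L].
Proof.
move=> sc nm tr [B0 [B0leaf [B0ind cB0]]] gs gi cV CV cC degV sumV.
have lin := scale_linear sc; have B0large := large_cube sc cB0.
case: (sc) => k100 kn nL Ln; have [_ f3 f4 f5] := scale_arith k100 kn nL Ln.
clear kn nL Ln cB0.
set h := L./2 in f3 f4; set D := L - h - 7 * k.
have hL : h <= L by apply: leq_trans f4; apply: leq_addr.
have Lm : 4 * L <= m by clear -lin f5 nm k100; lia.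
have [B [_ BB0 cB]] := @exists_between_card _ set0 _ L (sub0set _) (introT andP (conj (leq_trans (eq_leq (cards0 _)) (leq0n _)) B0large)).
have Bleaf x : x \in B -> #|nbr e x| = 1 by move=> /(subsetP BB0)/B0leaf/eqP.
have [_ esym eirr _ _] := tr.
have [root rB] : exists root, root \notin B.
  have /card_gt0P[r] : 0 < #|~: B| by have := cardsC B; rewrite cB card_ord; clear -Lm f4 k100; lia.
  by rewrite inE; exists r.
have [par [d rt]] := tree_rooted root tr.
have pB := parent_notin_leaves esym rt rB Bleaf.
have epar x : x \in B -> e x (par x).
  by case: rt => _ h2 _ xB; case: (h2 x) => //; apply: contraNneq rB => <-.
have pinj : {in B &, injective par}.
  move=> x y xB yB E; apply: (B0ind x y (par x)); rewrite ?(subsetP BB0) ?epar //.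
  by rewrite E epar.
pose V1 := V :\: C.
have [|H0 [HV1 cH0 _ Hd]] := @small_degree_core _ g V1 h D gs gi.
  apply: (@leq_ltn_trans (2 * (k - 1) * n)); last by rewrite -!mulnA ltn_mul2l.
  apply: leq_trans sumV; rewrite [leqRHS](big_setID V1) /=.
  rewrite (setIidPr (subsetDl _ _)); apply: leq_trans (leq_addr _ _).
  by apply: leq_sum => v _; apply/subset_leq_card/setSI/subsetDl.
pose H := C :|: H0; pose W := V :\: H.
have WE : V1 :\: H0 = W by rewrite /W /H /V1 setDDl.
rewrite WE in Hd.
have HV : H \subset V by rewrite subUset CV (subset_trans HV1) ?subsetDl.
have cH : #|H| <= h + k.
  by apply: leq_trans (leq_card_setU _ _).1 _; rewrite addnC leq_add.
have cW : #|W| = m - #|H| by rewrite cardsD (setIidPr HV) cV.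
have WV : W \subset V by apply: subsetDl.
have u0 : U.
  have /card_gt0P/sigW[u _] : 0 < #|V| by rewrite cV; clear -Lm f4 k100; lia.
  exact: u.
have [||B1 [_ B1B cB1]] := @exists_between_card _ set0 B #|H|; first exact: sub0set.
  by rewrite cards0 cB leq0n /=; apply: leq_trans cH _; clear -f4; lia.
have [|tau [tinj tH _]] := @conflict_free_bijection _ _ u0 B1 H (fun _ _ => false) cB1.
  by [].
pose Low := [set v in W | #|V :&: nbr g v| <= 6 * k].
have cLow : 3 * (#|W| - #|Low|) <= n.
  apply: card_low WV sumV _; rewrite mulnA [leqRHS]mulnC leq_mul2r; apply/orP; right.
  by clear -k100; lia.
pose Cand x := [set p in Low | [forall b in B1, (par b == x) ==> ~~ g p (tau b)]].
have cCand x : 2 * #|Low| <= 2 * #|Cand x| + (n + 3 * L + 4 * k).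
  have [/existsP[b /andP[bB1 /eqP pb]]|no] := boolP [exists b in B1, par b == x]; last first.
    have -> : Cand x = Low.
      apply/setP => p; rewrite [LHS]inE; case: (p \in Low) => //=; apply/forallP => b; apply/implyP => bB1.
      by apply/implyP => pb; case/negP: no; apply/existsP; exists b; rewrite bB1.
    exact: leq_addr.
  have tbV : tau b \in V by apply: (subsetP HV); apply: tH.
  have s1 : Low :\: nbr g (tau b) \subset Cand x.
    apply/subsetP => p; rewrite inE => /andP[np pL]; rewrite inE pL /=.
    apply/forallP => b'; apply/implyP => b'B1; apply/implyP => /eqP pb'.
    have -> : b' = b by apply: pinj; rewrite ?(subsetP B1B) // pb pb'.
    by move: np; rewrite inE gs.
  have s2 : Low :&: nbr g (tau b) \subset V :&: nbr g (tau b).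
    by apply: setSI; apply/subsetP => p; rewrite !inE => /andP[/andP[_ ->]].
  have := degV _ tbV; have := subset_leq_card s1; have := subset_leq_card s2.
  have := cardsID (nbr g (tau b)) Low; clear.
  move: #|Low| #|Cand x| #|V :&: _| #|Low :&: _| #|Low :\: _| => *; lia.
pose P := par @: B.
have cP : #|P| = L by rewrite (card_in_imset pinj).
have [|||||||||||phi [_ gphi phiW phiP]] :=
    @skeleton_embedding _ _ g par d set0 P (~: B) W Cand (fun=> u0) D (6 * k) gs gi.
- exact: rooted_decreasing rt.
- exact: sub0set.
- by apply/subsetP => _ /imsetP[x _ ->]; rewrite inE.
- by move=> x _; rewrite inE.
- by split=> x; rewrite ?inE // => y; rewrite inE.
- by move=> x; rewrite inE.
- by move=> x; apply/subsetP => v; rewrite !inE => /andP[/andP[]].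
- move=> x q; rewrite inE => /andP[]; rewrite inE => /andP[_ + _]; apply: leq_trans.
  by apply/subset_leq_card/setSI.
- move=> x _; have := cCand x; rewrite cP; move: cLow; rewrite cW; move: #|H| cH #|Low| #|Cand x|.
  by clear -hL nm lin f5 k100 => cH *; lia.
- exact: Hd.
- have := cardsC B; rewrite cB card_ord cW; move: #|H| cH #|~: B|.
  by clear -f4 Lm hL; rewrite /D; clearbody h => *; lia.
have phiV x : x \in ~: B -> phi x \in V by move=> /phiW; apply: (subsetP WV).
have cR : #|B :\: B1| = #|W :\: phi @: (~: B)|.
  rewrite (card_setD_imset gphi.1 phiW) cW cardsD (setIidPr B1B) cB cB1.
  have := cardsC B; rewrite card_ord cB; move: #|H| cH #|~: B|; clear -f4 Lm; clearbody h => *; lia.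
have [|psi [sinj sR sc']] := @conflict_free_bijection _ _ u0 (B :\: B1) _ (fun x r => g (phi (par x)) r) cR.
  move=> a r /setDP[aB _] /setDP[rW _] _.
  have r1 : #|[set r' in W :\: phi @: (~: B) | g (phi (par a)) r']| <= 6 * k.
    have := phiP _ (imset_f par aB); rewrite inE => /andP[+ _]; rewrite inE => /andP[_]; apply: leq_trans.
    apply/subset_leq_card/subsetP => v; rewrite !inE => /andP[/andP[_ /andP[_ ->]] ->] //.
  have r2 : #|[set a' in B :\: B1 | g (phi (par a')) r]| <= D.
    apply: leq_trans (Hd _ rW).
    have inj' : {in [set a' in B :\: B1 | g (phi (par a')) r] &, injective (phi \o par)}.
      move=> x y; rewrite !inE => /andP[/andP[_ xB] _] /andP[/andP[_ yB] _] /= E.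
      by apply: pinj => //; apply: gphi.1; rewrite ?inE.
    rewrite -(card_in_imset inj'); apply/subset_leq_card/subsetP => _ /imsetP[x xP ->].
    move: xP; rewrite inE => /andP[_ gx]; rewrite inE [_ \in nbr _ _]inE /= gs gx andbT.
    by apply: phiW; rewrite inE.
  rewrite cardsD (setIidPr B1B) cB cB1; apply: leq_trans (leq_add r1 r2) _.
  by move: #|H| cH; clear -f4; rewrite /D; clearbody h => *; lia.
pose chi x := if x \in B1 then tau x else psi x.
have [||||f [finj fV fg fphi fchi]] := @attach_leaves _ _ e g root par d B V phi chi gs rt pB gphi.
- by move=> x xB; apply: phiV; rewrite inE.
- move=> x y xB yB; rewrite /chi; case: ifPn => xB1; case: ifPn => yB1.
  + exact: tinj.
  + move=> E; have := sR y; rewrite !inE yB yB1 -E -in_setU tH //= andbF.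
    by move=> /(_ isT).
  + move=> E; have := sR x; rewrite !inE xB xB1 E -in_setU tH //= andbF.
    by move=> /(_ isT).
  + by apply: sinj; rewrite inE ?xB1 ?yB1.
- move=> x xB; rewrite /chi; case: ifPn => xB1.
    rewrite inE (subsetP HV) ?tH // andbT; apply/negP => /imsetP[y yB E].
    by have := phiW y yB; rewrite -E inE tH.
  have := sR x; rewrite inE xB xB1 => /(_ isT); rewrite !inE => /andP[-> /andP[_ ->]] //.
- move=> x xB; rewrite /chi; case: ifPn => xB1; last by apply: sc'; rewrite inE xB1.
  have := phiP _ (imset_f par xB); rewrite inE => /andP[_ /forallP/(_ x)/implyP/(_ xB1)].
  by rewrite eqxx.
exists f; split=> // x; have [xB|xB] := boolP (x \in B); first by left; apply: Bleaf.
right; rewrite fphi ?inE //; have := phiW x; rewrite inE => /(_ xB) fW; split.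
  by move: fW; rewrite !inE negb_or => /andP[/andP[]].
have := Hd _ fW; have : #|V :&: nbr g (phi x)| <= #|W :&: nbr g (phi x)| + #|H|.
  rewrite -cardsUI; apply: leq_trans (leq_addr _ _); apply/subset_leq_card/subsetP => v.
  rewrite in_setI => /andP[vV gv]; rewrite in_setU in_setI gv andbT in_setD vV andbT.
  by case: (v \in H).
by move: #|H| cH #|W :&: _| #|V :&: _|; clear -f4; rewrite /D; clearbody h => *; lia.
Qed.

(** * Packing *)

Section ImageGraph.
Variables (I U : finType) (e : rel I) (h : I -> U).

Definition image_rel : rel U :=
  fun u v => [exists x, [exists y, [&& e x y, h x == u & h y == v]]].

Lemma image_relP u v : reflect (exists x y, [/\ e x y, h x = u & h y = v]) (image_rel u v).
Proof.
apply: (iffP existsP) => [[x /existsP[y /and3P[? /eqP ? /eqP ?]]]|[x [y [exy <- <-]]]].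
  by exists x, y.
by exists x; apply/existsP; exists y; rewrite exy !eqxx.
Qed.

Lemma image_rel_sym : symmetric e -> symmetric image_rel.
Proof.
move=> es u v; apply/image_relP/image_relP => -[x [y [exy <- <-]]];
  by exists y, x; rewrite es.
Qed.

Lemma nbr_image_out v : (forall x, h x != v) -> nbr image_rel v = set0.
Proof.
move=> nv; apply/setP => u; rewrite !inE; apply/negbTE/negP => /image_relP[x [_ [_ E _]]].
by have := nv x; rewrite E eqxx.
Qed.

Hypothesis hinj : injective h.

Lemma nbr_image x : nbr image_rel (h x) = h @: nbr e x.
Proof.
apply/setP => v; rewrite inE; apply/image_relP/imsetP => [[x' [y [exy /hinj E <-]]]|[y]].
  by exists y; rewrite // inE -E.
by rewrite inE => exy ->; exists x, y.
Qed.

Lemma card_nbr_image x : #|nbr image_rel (h x)| = #|nbr e x|.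
Proof. by rewrite nbr_image card_imset. Qed.

Lemma sum_degree_image : \sum_v #|nbr image_rel v| <= \sum_x #|nbr e x|.
Proof.
rewrite (bigID (mem (h @: setT))) /= [X in _ + X]big1 ?addn0 => [|v vh]; last first.
  by rewrite nbr_image_out ?cards0 // => x; apply: contra vh => /eqP <-; apply: imset_f.
rewrite big_imset /=; last by move=> x y _ _; apply: hinj.
by apply: eq_leq; apply: eq_big => [x|x _]; rewrite ?inE // card_nbr_image.
Qed.
End ImageGraph.

Lemma sum_degree_tree (m : nat) (e : rel 'I_m) : is_tree e -> \sum_x #|nbr e x| <= 2 * m.
Proof.
move=> tr; have [m0 _ _ _ _] := tr.
have [par [d [_ _ er]]] := tree_rooted (Ordinal m0) tr.
apply: (@leq_trans (\sum_(x : 'I_m) (1 + \sum_(y | par y == x) 1))).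
  apply: leq_sum => x _; rewrite sum1dep_card -(cards1 (par x)).
  apply: leq_trans (leq_card_setU _ _).1; apply/subset_leq_card/subsetP => y.
  by rewrite !inE => /er[->|->]; rewrite eqxx ?orbT.
rewrite big_split /= sum1_card card_ord.
have <- : \sum_(y : 'I_m) 1 = \sum_x \sum_(y | par y == x) 1.
  by rewrite (partition_big par predT).
by rewrite sum1_card card_ord mul2n addnn.
Qed.

Lemma card_bigcup_leq (J U : finType) (P : pred J) (F : J -> {set U}) :
  #|\bigcup_(j | P j) F j| <= \sum_(j | P j) #|F j|.
Proof.
elim/big_rec2: _ => [|j s A _ le]; first by rewrite cards0.
by apply: leq_trans (leq_card_setU _ _).1 _; rewrite leq_add2l.
Qed.

Lemma card_smaller k (i : 'I_k) : #|[set j : 'I_k | j < i]| <= i.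
Proof.
rewrite -[X in _ <= X]card_ord; apply: leq_trans (leq_imset_card (widen_ord (ltnW (ltn_ord i))) _).
apply/subset_leq_card/subsetP => j; rewrite inE => ji.
by apply/imsetP; exists (Ordinal ji) => //; apply: val_inj.
Qed.

Lemma set2_eqE (U : finType) (a b c d : U) :
  a != b -> [set a; b] = [set c; d] -> a = c /\ b = d \/ a = d /\ b = c.
Proof.
move=> ab /setP E; have := E a; have := E b; rewrite !inE !eqxx orbT /= => /esym/orP[]/eqP bE /esym/orP[]/eqP aE;
  by [left|right|rewrite aE bE eqxx in ab].
Qed.

Section Packing.
Variables (n k L : nat) (kn : k <= n) (T : forall i : 'I_k, rel 'I_(n - i)) (A : {set 'I_k}).
Hypotheses (sc : scale n k L) (Ttree : forall i, is_tree (@T i)).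
Hypotheses (TA : forall i, i \in A -> cond1 n (@T i))
  (TB : forall i, i \notin A -> ~ cond1 n (@T i) /\ cond2 n (@T i)).

Let T_sym i : symmetric (@T i). Proof. by case: (Ttree i). Qed.

Definition center (j : 'I_k) : 'I_n := widen_ord kn j.

Lemma center_inj : injective center.
Proof. by move=> i j /(congr1 val) /= /val_inj. Qed.

Definition used (J : {set 'I_k}) (f : forall i : 'I_k, 'I_(n - i) -> 'I_n) : rel 'I_n :=
  fun u v => [exists i in J, image_rel (@T i) (f i) u v].

(* The vertex center j is kept for T j with j in A: it is avoided by the smaller trees and is a leaf of the larger trees outside A. The degree bound matters only while no tree of A has been embedded. *)
Record partial_packing (J : {set 'I_k}) (f : forall i : 'I_k, 'I_(n - i) -> 'I_n) : Prop := PartialPacking {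
  pp_inj : forall i, i \in J -> injective (f i);
  pp_disj : forall i j, i \in J -> j \in J -> i != j -> forall x y u v,
    T x y -> T u v -> f i x = f j u -> f i y = f j v -> False;
  pp_avoid : forall i j, i \in J -> j \in A -> j < i -> forall x, f i x != center j;
  pp_leaf : forall i j, i \in J -> i \notin A -> j \in A -> i < j -> forall x,
    f i x = center j -> #|nbr (@T i) x| = 1;
  pp_degree : J \subset ~: A -> forall v,
    2 * #|nbr (used J f) v| <= n + 3 * L + 2 * k + 2 * #|J|;
  pp_sum : \sum_v #|nbr (used J f) v| <= 2 * #|J| * n }.

Lemma used_sym J f : symmetric (used J f).
Proof. by move=> u v; apply: eq_existsb => i; rewrite (image_rel_sym _ (@T_sym i)). Qed.

Lemma used_irr J f : partial_packing J f -> irreflexive (used J f).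
Proof.
move=> pp u; apply/negbTE/negP => /existsP[i /andP[iJ /image_relP[x [y [exy <- E]]]]].
have xy : y = x by apply: (pp_inj pp iJ).
by case: (Ttree i) => _ _ irr _ _; move: exy; rewrite xy (negPf (irr x)).
Qed.

Lemma nbr_used J f v : nbr (used J f) v = \bigcup_(i in J) nbr (image_rel (@T i) (f i)) v.
Proof.
apply/setP => u; rewrite inE; apply/existsP/bigcupP => [[i /andP[iJ h]]|[i iJ h]].
  by exists i; rewrite ?inE.
by exists i; rewrite iJ; move: h; rewrite inE.
Qed.

Lemma used_extend (J : {set 'I_k}) (f : forall i : 'I_k, 'I_(n - i) -> 'I_n) (i : 'I_k) (h : 'I_(n - i) -> 'I_n) v : i \notin J ->
  nbr (used (i |: J) (dfwith f h)) v = nbr (image_rel (@T i) h) v :|: nbr (used J f) v.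
Proof.
move=> iJ; rewrite !nbr_used big_setU1 //= dfwith_in; congr (_ :|: _).
apply: eq_bigr => j jJ; rewrite dfwith_out //.
by apply: contraNneq iJ => ->.
Qed.

Lemma extend_packing (J : {set 'I_k}) (f : forall i : 'I_k, 'I_(n - i) -> 'I_n) (i : 'I_k) (h : 'I_(n - i) -> 'I_n) : i \notin J -> partial_packing J f ->
  injective h -> (forall x y, T x y -> ~~ used J f (h x) (h y)) ->
  (forall j, j \in A -> j < i -> forall x, h x != center j) ->
  (forall j, i \notin A -> j \in A -> i < j -> forall x, h x = center j -> #|nbr (@T i) x| = 1) ->
  (J \subset ~: A -> i \notin A -> forall x,
    2 * (#|nbr (@T i) x| + #|nbr (used J f) (h x)|) <= n + 3 * L + 2 * k + 2 * #|J|.+1) ->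
  partial_packing (i |: J) (dfwith f h).
Proof.
move=> iJ pp hinj hdisj havoid hleaf hdeg.
have old j : j \in J -> dfwith f h j = f j.
  by move=> jJ; rewrite dfwith_out //; apply: contraNneq iJ => ->.
split.
- by move=> j /setU1P[->|jJ]; rewrite ?dfwith_in // old //; apply: (pp_inj pp).
- move=> j1 j2 /setU1P[->|j1J] /setU1P[->|j2J] ne x y u v; rewrite ?dfwith_in ?old //.
  + by rewrite eqxx in ne.
  + move=> exy euv E1 E2; have /negP[] := hdisj x y exy.
    apply/existsP; exists j2; rewrite j2J; apply/image_relP; by exists u, v.
  + move=> exy euv E1 E2; have /negP[] := hdisj u v euv.
    apply/existsP; exists j1; rewrite j1J; apply/image_relP; by exists x, y.
  + exact: (pp_disj pp).
- move=> j1 j2 /setU1P[->|j1J]; rewrite ?dfwith_in ?old //; [exact: havoid|exact: (pp_avoid pp)].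
- move=> j1 j2 /setU1P[->|j1J]; rewrite ?dfwith_in ?old //; [exact: hleaf|exact: (pp_leaf pp)].
- rewrite subUset sub1set inE => /andP[iA JA] v; rewrite used_extend // cardsU1 iJ add1n.
  have [/existsP[x /eqP xv]|nv] := boolP [exists x, h x == v].
    apply: leq_trans (hdeg JA iA x); rewrite leq_mul2l -xv -(card_nbr_image _ hinj).
    exact: (leq_card_setU _ _).1.
  rewrite nbr_image_out ?set0U => [|x]; last by apply: contra nv => E; apply/existsP; exists x.
  apply: leq_trans (pp_degree pp JA v) _; rewrite leq_add2l leq_mul2l; exact: leqnSn.
- rewrite cardsU1 iJ add1n mulnSr mulnDl [leqRHS]addnC.
  have c1 : \sum_v #|nbr (image_rel (@T i) h) v| <= 2 * n.
    apply: leq_trans (sum_degree_image _ hinj) _; apply: leq_trans (sum_degree_tree (Ttree i)) _.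
    by rewrite leq_mul2l leq_subr.
  apply: leq_trans (leq_add c1 (pp_sum pp)).
  rewrite -big_split /=; apply: leq_sum => v _; rewrite used_extend //.
  exact: (leq_card_setU _ _).1.
Qed.

Lemma sum_degree_within (J : {set 'I_k}) (f : forall i : 'I_k, 'I_(n - i) -> 'I_n) (i : 'I_k) (V : {set 'I_n}) : partial_packing J f -> i \notin J ->
  \sum_(v in V) #|V :&: nbr (used J f) v| <= 2 * (k - 1) * n.
Proof.
move=> pp iJ; apply: (@leq_trans (\sum_v #|nbr (used J f) v|)).
  rewrite big_mkcond; apply: leq_sum => v _; case: ifP => // _.
  exact: subset_leq_card (subsetIr _ _).
apply: leq_trans (pp_sum pp) _; rewrite -!mulnA leq_mul2l leq_mul2r; apply/orP; right; apply/orP; right.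
have : #|i |: J| <= k by rewrite -[X in _ <= X]card_ord max_card.
by rewrite cardsU1 iJ add1n; move: #|J| => c; clear; lia.
Qed.

Lemma extend_cond2 (J : {set 'I_k}) (f : forall i : 'I_k, 'I_(n - i) -> 'I_n) (i : 'I_k) : i \notin A -> i \notin J -> J \subset ~: A -> partial_packing J f ->
  exists f', partial_packing (i |: J) f'.
Proof.
move=> iA iJ JA pp; set g := used J f.
have cJ : #|i |: J| <= k by rewrite -[X in _ <= X]card_ord max_card.
rewrite cardsU1 iJ add1n in cJ.
pose bad := center @: [set j in A | j < i].
have cbad : #|bad| <= i.
  apply: leq_trans (leq_imset_card _ _) _; apply: leq_trans (card_smaller i).
  by apply/subset_leq_card/subsetP => j; rewrite !inE => /andP[].
have [||V [_ Vbad cV]] := @exists_between_card _ set0 (~: bad) (n - i); first exact: sub0set.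
  by rewrite cards0 /=; have := cardsC bad; rewrite card_ord; move: #|bad| #|~: bad| cbad; clear; lia.
pose C := [set center j | j in A] :&: V.
have cC : #|C| <= k.
  apply: leq_trans (subset_leq_card (subsetIl _ _)) _; apply: leq_trans (leq_imset_card _ _) _.
  by rewrite -[X in _ <= X]card_ord max_card.
have [nc1 c2] := TB iA.
have ik : i < k := ltn_ord i.
have [||h [hinj hV hdisj hdeg]] := @embed_cond2 _ g V C n k L _ _ sc _ (Ttree i) c2 (@used_sym J f) (used_irr pp) cV (subsetIr _ _) cC _ (sum_degree_within V pp iJ).
- by apply: leq_sub2l; apply: ltnW.
- move=> v _; apply: leq_trans (_ : 2 * #|nbr g v| <= _).
    by rewrite leq_mul2l subset_leq_card // subsetIr.
  by apply: leq_trans (pp_degree pp JA v) _; move: #|J| cJ; clear; lia.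
exists (dfwith f h); apply: extend_packing => //.
- move=> j jA ji x; apply/eqP => E; have := subsetP Vbad _ (hV x); rewrite inE => /negP[].
  by rewrite E; apply: imset_f; rewrite inE jA.
- move=> j _ jA ij x E; case: (hdeg x) => // -[/negP[]].
  by rewrite inE hV andbT E; apply: imset_f.
- move=> _ _ x; case: (hdeg x) => [->|[_ dL]].
    have := pp_degree pp JA (h x); rewrite -/g; move: #|nbr g _| #|J|; clear; lia.
  have := degree_not_cond1 x sc (leq_subr i n) (Ttree i) nc1.
  have : #|nbr g (h x)| <= L + i.
    rewrite -(cardsID V) setIC leq_add //; apply: leq_trans (subset_leq_card (_ : _ \subset ~: V)) _.
      by apply/subsetP => v; rewrite !inE => /andP[].
    by have := cardsC V; rewrite cV card_ord; move: #|~: V| (kn) ik; clear; lia.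
  by rewrite -/g; move: #|nbr g _| #|nbr _ x| #|J| (ik); clear; lia.
Qed.

(* center i has at most one neighbour in each T j with j < i outside A and none in the other embedded trees, so enough vertices remain to host T i with center i isolated. *)
Lemma extend_cond1 (J : {set 'I_k}) (f : forall i : 'I_k, 'I_(n - i) -> 'I_n) (i : 'I_k) : i \in A -> i \notin J -> (forall j, j \in J -> (j \notin A) || (i < j)) ->
  partial_packing J f -> exists f', partial_packing (i |: J) f'.
Proof.
move=> iA iJ JP pp; set g := used J f.
have ik : i < k := ltn_ord i.
have c1 : #|nbr g (center i)| <= #|[set j : 'I_k | (j \notin A) && (j < i)]|.
  rewrite nbr_used; apply: leq_trans (card_bigcup_leq _ _) _.
  rewrite -sum1_card big_mkcond [leqRHS]big_mkcond /=; apply: leq_sum => j _.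
  case: ifP => // jJ; rewrite inE.
  have [/existsP[x /eqP xc]|nx] := boolP [exists x, f j x == center i]; last first.
    rewrite nbr_image_out ?cards0 // => x; apply: contra nx => E; apply/existsP.
    by exists x.
  rewrite -xc card_nbr_image; last exact: (pp_inj pp).
  have nij : ~~ (i < j) by apply/negP => ij; have := pp_avoid pp jJ iA ij x; rewrite xc eqxx.
  have jA : j \notin A by have := JP j jJ; rewrite (negPf nij) orbF.
  have ji : j < i.
    by rewrite ltn_neqAle leqNgt nij andbT; apply: contraNneq jA => /val_inj ->.
  by rewrite jA ji (pp_leaf pp jJ jA iA ji xc).
pose bad := center @: [set j in A | j < i] :|: nbr g (center i).
have cbad : #|bad| <= i.
  apply: leq_trans (leq_card_setU _ _).1 _; apply: leq_trans (leq_add (leq_imset_card _ _) c1) _.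
  apply: leq_trans (card_smaller i).
  rewrite -(cardsID A [set j : 'I_k | j < i]) leq_add //; apply/subset_leq_card/subsetP => j.
    by rewrite !inE => /andP[-> ->].
  by rewrite !inE.
have [||V [ciV Vbad cV]] := @exists_between_card _ [set center i] (~: bad) (n - i).
- rewrite sub1set !inE negb_or (used_irr pp : irreflexive g) andbT.
  apply/negP => /imsetP[j]; rewrite inE => /andP[_ ji] /center_inj E.
  by rewrite E ltnn in ji.
- rewrite cards1; have := cardsC bad; rewrite card_ord; move: #|bad| #|~: bad| cbad (kn) ik; clear; lia.
have {}ciV : center i \in V by rewrite -sub1set.
have [||h [hinj hV hdisj]] := @embed_cond1 _ g V (center i) n k L _ _ sc _ (Ttree i) (TA iA) (@used_sym J f) (used_irr pp) cV ciV _ (sum_degree_within V pp iJ).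
- by apply: leq_sub2l; apply: ltnW.
- by move=> u /(subsetP Vbad); rewrite inE in_setU negb_or inE => /andP[].
exists (dfwith f h); apply: extend_packing => //.
- move=> j jA ji x; apply/eqP => E; have := subsetP Vbad _ (hV x); rewrite inE => /negP[].
  by rewrite E inE; apply/orP; left; apply: imset_f; rewrite inE jA.
- by move=> j; rewrite iA.
- by move=> _; rewrite iA.
Qed.

Lemma full_packing : exists f, partial_packing setT f.
Proof.
have HB p (J : {set 'I_k}) : #|J| = p -> J \subset ~: A -> exists f, partial_packing J f.
  elim: p J => [|p IH] J cJ JA.
    have n0 : 0 < n.
      case: sc => k100 kn3 _ _; apply: leq_trans kn3; rewrite expn_gt0; move: k100; clear; lia.
    have -> : J = set0 by apply/eqP; rewrite -cards_eq0 cJ.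
    exists (fun i x => Ordinal n0).
    have un v : nbr (used set0 (fun i x => Ordinal n0)) v = set0 by rewrite nbr_used big_set0.
    split=> [i|i j|i j|i j|_ v|]; rewrite ?inE ?un ?cards0 //.
    by rewrite big1 // => v _; rewrite un cards0.
  have [i iJ] : exists i, i \in J by apply/card_gt0P; rewrite cJ.
  have [||f pp] := IH (J :\ i).
  - by move: cJ; rewrite (cardsD1 i) iJ => -[].
  - by apply: subset_trans JA; apply: subD1set.
  rewrite -(setD1K iJ); apply: extend_cond2 pp; rewrite ?inE ?eqxx //.
    by have := subsetP JA i iJ; rewrite inE.
  by apply: subset_trans JA; apply: subD1set.
have HA p : exists f, partial_packing [set i : 'I_k | (i \notin A) || (k <= i + p)] f.
  elim: p => [|p [f pp]].
    apply: (HB _ _ erefl); apply/subsetP => i; rewrite !inE addn0.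
    by rewrite leqNgt ltn_ord orbF.
  have [pk|pk] := leqP k p.
    exists f; congr (partial_packing _ f): pp; apply/setP => i; rewrite !inE.
    by rewrite !(leq_trans pk) ?orbT // ?leq_addl // addnS ltnW // ltnS leq_addl.
  have ik : k - p.+1 < k by move: pk; clear; lia.
  pose i0 := Ordinal ik.
  have i0E (i : 'I_k) : (k <= i + p.+1) = (i == i0) || (k <= i + p).
    by rewrite -val_eqE /=; move: pk; clear; case: i => i /=; lia.
  have [i0A|i0A] := boolP (i0 \in A); last first.
    exists f; congr (partial_packing _ f): pp; apply/setP => i; rewrite !inE i0E.
    by have [->|_ //] := eqVneq i i0; rewrite i0A.
  have [||f' pp'] := @extend_cond1 _ f i0 i0A _ _ pp.
  - by rewrite inE i0A /=; move: pk; clear; lia.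
  - by move=> j; rewrite inE => /orP[->//|kj]; apply/orP; right; move: kj pk; clear; rewrite /=; lia.
  exists f'; congr (partial_packing _ f'): pp'; apply/setP => i; rewrite !inE i0E.
  by have [->|_ //] := eqVneq i i0; rewrite i0A.
have [f pp] := HA k; exists f; congr (partial_packing _ f): pp.
by apply/setP => i; rewrite !inE leq_addl orbT.
Qed.

End Packing.

Lemma exists_scale n : (4 * 100) ^ 3 <= n -> exists L, scale n (tcount n) L.
Proof.
move=> n0.
have n1 : 0 < n by apply: leq_trans n0; rewrite expn_gt0.
have nn : 100 <= n.
  by apply: leq_trans n0; apply: (@leq_trans ((4 * 100) ^ 1)); rewrite ?leq_pexp2l.
have k100 : 100 <= tcount n.
  exact: (@leq_bigmax_cond _ (fun k : 'I_n.+1 => (4 * k) ^ 3 <= n) (fun k => k : nat) (Ordinal (nn : 100 < n.+1)) n0).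
have kn : (4 * tcount n) ^ 3 <= n.
  rewrite /tcount; apply: (big_ind (fun k => (4 * k) ^ 3 <= n)) => // x y hx hy.
  by rewrite /maxn; case: ifP.
have exL : exists L, n ^ 2 <= L ^ 3 by exists n; apply: leq_pexp2l.
exists (ex_minn exL); case: ex_minnP => L nL Lmin; split=> //.
rewrite ltnNge; apply/negP => /Lmin LL.
have L0 : L = 0 by move: LL; clear; lia.
by move: nL; rewrite L0 exp0n // leqn0 expn_eq0; move: n1; clear; lia.
Qed.

(* Trees indexed zero-based: T i (i : 'I_t) is T_{i+1}, with n - i vertices. *)
Theorem theorem3 : exists n0 : nat, forall n : nat, n0 <= n ->
  forall T : forall i : 'I_(tcount n), rel 'I_(n - i),
    (forall i, is_tree (T i) /\ (cond1 n (T i) \/ cond2 n (T i))) ->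
    @packs_into_Kn n _ (fun i : 'I_(tcount n) => n - i) T.
Proof.
exists ((4 * 100) ^ 3) => n n0 T HT; have [L sc] := exists_scale n0.
have kn : tcount n <= n.
  case: sc => k100 kn _ _; apply: leq_trans kn; apply: leq_trans (leq_pmull _ (isT : 0 < 4)) _.
  by rewrite -{1}[4 * _]expn1 leq_pexp2l // muln_gt0 /=; apply: leq_trans k100.
pose c1 (i : 'I_(tcount n)) := [exists S : {set 'I_(n - i)}, (#|S| ^ 3 <= n) &&
  (n ^ 2 <= #|[set x | is_leaf (T i) x && (x \notin S) && [exists s in S, T i s x]]| ^ 3)].
have c1P i : reflect (cond1 n (T i)) (c1 i).
  apply: (iffP existsP) => [[S /andP[? ?]]|[S [? ?]]]; exists S => //.
  by apply/andP.
have [|||f pp] := @full_packing n (tcount n) L kn T [set i | c1 i] sc.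
- by move=> i; case: (HT i).
- by move=> i; rewrite inE => /c1P.
- move=> i; rewrite inE => /c1P nc; split=> //.
  by case: (HT i) => _ [/nc|].
exists f; split=> [i|i j x y u v ne exy euv]; first exact: (pp_inj pp (in_setT i)).
apply/eqP => E; have disj := pp_disj pp (in_setT i) (in_setT j) ne exy.
have fxy : f i x != f i y.
  rewrite (inj_eq (pp_inj pp (in_setT i))); apply: contraTneq exy => ->.
  by case: (HT i) => -[_ _ irr _ _] _; apply: irr.
case: (set2_eqE fxy E) => -[]; first exact: disj euv.
by apply: disj; case: (HT j) => -[_ es _ _ _] _; rewrite es.
Qed.
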